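(* Let $\omega=e^{2\pi i/3}$ and let $\alpha\in\overline{\mathbf{Q}}\setminus\mathbf{Q}(\omega)$. Consider the complex foliation $\mathcal{F}^4_\alpha$ on $\mathbf{P}^2_{\mathbf{C}}$. For every closed point $\mathfrak{p}$ of $\operatorname{Spec}(R)$, $R=\mathbf{Z}[\alpha]$, whose residue characteristic $\ell$ is such that $\ell>3$ and $\ell\equiv2\pmod3$, the reduction modulo $\mathfrak{p}$ of the complex foliation $\mathcal{F}^4_\alpha$ is $\ell$-closed. Moreover, the set of such closed points $\mathfrak{p}$ is Zariski-dense in $\operatorname{Spec}(R)$.
   Context: $\mathcal{F}^4_\alpha$ is the foliation given by the kernel of the form $(y^3-z^3)(yz-\alpha x^2)\,dx+(z^3-x^3)(xz-\alpha y^2)\,dy+(x^3-y^3)(xy-\alpha z^2)\,dz$, whose coefficients lie in $R[x,y,z]$. For a closed point $\mathfrak{p}\in\operatorname{Spec}(R)$ with (finite) residue field $\kappa(\mathfrak{p})=R/\mathfrak{p}$ of characteristic $\ell$, the reduction of $\mathcal{F}^4_\alpha$ modulo $\mathfrak{p}$ is the foliation on $\mathbf{P}^2_{\kappa(\mathfrak{p})}$ defined by the reduction of this form modulo $\mathfrak{p}$. It is called $\ell$-closed if its base change to $\overline{\kappa(\mathfrak{p})}$ is $\ell$-closed: for every local generator $v$ of its tangent sheaf, $v\wedge v^{[\ell]}=0$, where $v^{[\ell]}$ denotes the $\ell$-fold composition of the derivation $v$ (again a derivation in characteristic $\ell$). *)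

(* Defs.v *)
From HB Require Import structures.
From mathcomp Require Import all_boot all_order all_algebra all_field.
From mathcomp Require Import boolp.
From mathcomp Require Import mpoly.
From mathcomp Require Import ring.

Set Implicit Arguments.
Unset Strict Implicit.
Unset Printing Implicit Defensive.

Import GRing.Theory Num.Theory.
Local Open Scope ring_scope.
Local Open Scope quotient_scope.

(* [algC], the algebraic closure of Q inside C, plays the role of Qbar, and
   [omega] is e^(2 pi i / 3) = cos (2 pi / 3) + i sin (2 pi / 3). *)
Definition omega : algC := (- 1 + 'i * sqrtC 3) / 2.

Definition Qadjoin (w x : algC) : Prop :=
  exists p q : {poly rat},
    (map_poly ratr q).[w] != 0 /\
    x = (map_poly ratr p).[w] / (map_poly ratr q).[w].

Section Zadjoin.
Variable alpha : algC.

Definition Zadjoin_pred : {pred algC} :=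
  fun x => `[< exists p : {poly int}, x = (map_poly intr p).[alpha] >].

Lemma Zadjoin_subring : subring_closed Zadjoin_pred.
Proof.
split.
- by apply/asboolP; exists 1; rewrite rmorph1 hornerC.
- move=> _ _ /asboolP[p ->] /asboolP[q ->]; apply/asboolP; exists (p - q).
  by rewrite rmorphB hornerD hornerN.
- move=> _ _ /asboolP[p ->] /asboolP[q ->]; apply/asboolP; exists (p * q).
  by rewrite rmorphM hornerM.
Qed.

HB.instance Definition _ :=
  GRing.isSubringClosed.Build algC Zadjoin_pred Zadjoin_subring.

Record Zadjoin := MkZadjoin { Zval : algC; _ : Zval \in Zadjoin_pred }.

HB.instance Definition _ := [isSub for Zval].
HB.instance Definition _ := [Choice of Zadjoin by <:].
HB.instance Definition _ := [SubChoice_isSubComNzRing of Zadjoin by <:].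

Lemma Zgen_subproof : alpha \in Zadjoin_pred.
Proof. by apply/asboolP; exists 'X; rewrite map_polyX hornerX. Qed.

Definition Zgen : Zadjoin := MkZadjoin Zgen_subproof.

End Zadjoin.

(* Boolean predicates are no restriction here: [boolp] makes every subset of R
   a boolean predicate. *)
Notation Spec R := (prime_idealr R).

Section Spectrum.
Variable R : comNzRingType.

(* [idealr R] is the type of proper ideals, so this is maximality of p. *)
Definition closed_point (p : Spec R) : Prop :=
  forall J : idealr R, {subset p <= J} -> {subset J <= p}.

Definition zero_locus (E : R -> Prop) (p : Spec R) : Prop :=
  forall f : R, E f -> f \in p.

Definition zariski_dense (S : Spec R -> Prop) : Prop :=
  forall E : R -> Prop,
    (forall p : Spec R, S p -> zero_locus E p) ->
    forall p : Spec R, zero_locus E p.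

End Spectrum.

(* R/p; it is a field as soon as p is a closed point. *)
Notation residue p := {ideal_quot p}.

(* [w] stands for w_0 dX_0 + w_1 dX_1 + w_2 dX_2. *)
Definition form1 (A : comNzRingType) := 'I_3 -> {mpoly A[3]}.

Definition map_form (A B : comNzRingType) (h : {rmorphism A -> B})
  (w : form1 A) : form1 B := fun i => map_mpoly h (w i).

Section F4.
Variables (A : comNzRingType) (a : A).

Let x : {mpoly A[3]} := 'X_(inord 0).
Let y : {mpoly A[3]} := 'X_(inord 1).
Let z : {mpoly A[3]} := 'X_(inord 2).

Definition F4 : form1 A := fun i =>
  nth 0 [:: (y ^+ 3 - z ^+ 3) * (y * z - a%:MP * x ^+ 2);
            (z ^+ 3 - x ^+ 3) * (x * z - a%:MP * y ^+ 2);
            (x ^+ 3 - y ^+ 3) * (x * y - a%:MP * z ^+ 2)] i.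

Lemma F4_homog i : F4 i \is 5.-homog.
Proof.
have hX (j : 'I_3) : ('X_j : {mpoly A[3]}) \is 1.-homog.
  by rewrite dhomogX /= mdeg1.
have hXn (j : 'I_3) n : ('X_j ^+ n : {mpoly A[3]}) \is n.-homog.
  by rewrite -[X in X.-homog]mul1n dhomogMn.
have hq (j k l : 'I_3) : ('X_j * 'X_k - a%:MP * 'X_l ^+ 2) \is 2.-homog.
  by rewrite rpredB ?mul_mpolyC ?rpredZ ?hXn// (@dhomogM _ _ _ 1 _ 1).
by case: i => [[|[|[|//]]] ?]; apply: (@dhomogM _ _ _ 3 _ 2);
  rewrite ?hq// rpredB ?hXn.
Qed.

(* The contraction with the Euler field vanishes, so the form descends to P^2. *)
Lemma F4_euler : \sum_(i < 3) 'X_i * F4 i = 0.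
Proof.
rewrite !big_ord_recl big_ord0 /F4 /=.
have -> : ord0 = inord 0 :> 'I_3 by apply: val_inj; rewrite /= inordK.
have -> : lift (inord 0) ord0 = inord 1 :> 'I_3.
  by apply: val_inj; rewrite /= !inordK.
have -> : lift (inord 0) (lift ord0 ord0) = inord 2 :> 'I_3.
  by apply: val_inj; rewrite /= !inordK.
rewrite -/x -/y -/z; ring.
Qed.

End F4.

Section SubfieldOf.
Variables (F : fieldType) (S : divringClosed F).

Record subfield_of := SubfieldOf { subfield_val : F; _ : subfield_val \in S }.

HB.instance Definition _ := [isSub for subfield_val].
HB.instance Definition _ := [Choice of subfield_of by <:].
HB.instance Definition _ := [SubChoice_isSubIntegralDomain of subfield_of by <:].
HB.instance Definition _ := [SubIntegralDomain_isSubField of subfield_of by <:].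

End SubfieldOf.

Local Notation "x %:F" := (@FracField.tofrac _ x).

Section Plane.
Variable L : closedFieldType.

Definition homog_frac : {pred {fraction {mpoly L[3]}}} := fun u =>
  `[< exists d (f g : {mpoly L[3]}),
        [/\ f \is d.-homog, g \is d.-homog, g != 0 & u = f%:F / g%:F] >].

Lemma homog_frac_divring : divring_closed homog_frac.
Proof.
split.
- apply/asboolP; exists 0%N, 1, 1.
  by rewrite dhomog1 oner_neq0 rmorph1 divr1.
- move=> _ _ /asboolP[d [f [g [hf hg g0 ->]]]]
    /asboolP[e [h [k [hh hk k0 ->]]]].
  apply/asboolP; exists (d + e)%N, (f * k - h * g), (g * k); split.
  + by rewrite rpredB ?(dhomogM hf hk)// addnC (dhomogM hh hg).
  + exact: dhomogM.
  + by rewrite mulf_neq0.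
  + by rewrite -[LHS]/(_ + _) -mulNr addf_div ?tofrac_eq0// tofracB !tofracM mulNr.
- move=> _ _ /asboolP[d [f [g [hf hg g0 ->]]]]
    /asboolP[e [h [k [hh hk k0 ->]]]].
  apply/asboolP; have [->|h0] := eqVneq h 0.
    by exists 0%N, 0, 1; rewrite dhomog0 dhomog1 oner_neq0 rmorph0 !(mul0r, invr0, mulr0).
  exists (d + e)%N, (f * k), (g * h); split; [exact: dhomogM..| |].
    by rewrite mulf_neq0.
  by rewrite !tofracM invf_div mulf_div.
Qed.

HB.instance Definition _ := GRing.isDivringClosed.Build
  {fraction {mpoly L[3]}} homog_frac homog_frac_divring.

(* The function field of P^2: the degree 0 part of L(X_0, X_1, X_2). *)
Definition funfield : fieldType :=
  subfield_of (homog_frac : divringClosed {fraction {mpoly L[3]}}).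

Definition fval (u : funfield) : {fraction {mpoly L[3]}} := \val u.

Lemma fconst_subproof (c : L) : (c%:MP : {mpoly L[3]})%:F \in homog_frac.
Proof.
apply/asboolP; exists 0%N, c%:MP, 1.
by rewrite -[c%:MP]mulr1 mul_mpolyC rpredZ dhomog1 // oner_neq0 rmorph1 divr1.
Qed.

Definition fconst (c : L) : funfield := SubfieldOf (fconst_subproof c).

Lemma fratio_subproof (i j : 'I_3) :
  ('X_i : {mpoly L[3]})%:F / ('X_j : {mpoly L[3]})%:F \in homog_frac.
Proof.
apply/asboolP; exists 1%N, 'X_i, 'X_j.
by split; rewrite ?dhomogX /= ?mdeg1// -msupp_eq0 msuppX.
Qed.

(* The affine coordinate X_i / X_j on the chart X_j <> 0. *)
Definition fratio (i j : 'I_3) : funfield := SubfieldOf (fratio_subproof i j).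

(* Closed points of P^2 are given by homogeneous coordinates q <> 0. *)
Definition ppoint (q : 'I_3 -> L) : Prop := exists i, q i != 0.

(* Membership in the local ring at q. *)
Definition regular_at (q : 'I_3 -> L) (u : funfield) : Prop :=
  exists d (f g : {mpoly L[3]}),
    [/\ f \is d.-homog, g \is d.-homog, g.@[q] != 0 & fval u = f%:F / g%:F].

(* The open subset of P^2 where the elements of E do not all vanish; every
   Zariski-open subset is of this form with E made of homogeneous elements. *)
Definition popen (E : {mpoly L[3]} -> Prop) (q : 'I_3 -> L) : Prop :=
  ppoint q /\ exists2 f, E f & f.@[q] != 0.

Definition homog_family (E : {mpoly L[3]} -> Prop) : Prop :=
  forall f, E f -> exists d, f \is d.-homog.

(* An L-derivation of the function field, i.e. a rational vector field. *)
Definition vfield (v : funfield -> funfield) : Prop :=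
  [/\ forall c, v (fconst c) = 0,
      {morph v : f g / f + g} &
      forall f g, v (f * g) = v f * g + f * v g].

(* v is annihilated by the form. If w is homogeneous of degree d and
   \sum_i X_i w_i = 0, then w / X_j ^ (d + 1) restricts on the chart X_j <> 0
   to the 1-form \sum_i (w_i / X_j ^ d) d(X_i / X_j); the invertible factor
   X_j ^ d is cleared below. *)
Definition in_kernel (w : form1 L) (v : funfield -> funfield) : Prop :=
  forall j : 'I_3, \sum_(i < 3) (w i)%:F * fval (v (fratio i j)) = 0.

(* The stalk at q of the tangent sheaf of the foliation: since P^2 is smooth,
   the stalk of its tangent sheaf consists of the derivations of the function
   field preserving the local ring. *)
Definition tangent_at (w : form1 L) (q : 'I_3 -> L)
    (v : funfield -> funfield) : Prop :=
  [/\ vfield v, in_kernel w v & forall f, regular_at q f -> regular_at q (v f)].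

Definition generates_at (w : form1 L) (q : 'I_3 -> L)
    (v : funfield -> funfield) : Prop :=
  tangent_at w q v /\
  forall v', tangent_at w q v' ->
    exists2 h, regular_at q h & forall f, v' f = h * v f.

Definition local_generator (w : form1 L) (v : funfield -> funfield) : Prop :=
  exists E : {mpoly L[3]} -> Prop,
    [/\ homog_family E, exists q, popen E q &
        forall q, popen E q -> generates_at w q v].

(* The bivector u /\ v, as an alternating function of two differentials df, dg. *)
Definition wedge (u v : funfield -> funfield) (f g : funfield) : funfield :=
  u f * v g - u g * v f.

Definition p_closed (l : nat) (w : form1 L) : Prop :=
  forall v, local_generator w v ->
    forall f g, wedge v (iter l v) f g = 0.

End Plane.

Section Reduction.
Variable R : comNzRingType.

Definition reduction (p : Spec R) (w : form1 R) : form1 (residue p) :=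
  map_form (\pi_(residue p) : {rmorphism R -> residue p}) w.

(* l-closedness after base change to an algebraic closure of the residue
   field; such a closure is an algebraically closed field L together with an
   embedding iota of R/p over which it is algebraic. *)
Definition p_closed_mod (p : Spec R) (l : nat) (w : form1 (residue p)) :
    Prop :=
  forall (L : closedFieldType) (iota : {rmorphism residue p -> L}),
    integralRange iota -> p_closed l (map_form iota w).

Definition residue_char (p : Spec R) (l : nat) : Prop := l \in [pchar residue p].

End Reduction.

(* Main.v *)
(* In characteristic l = 3m + 2 the form F4 becomes exact after multiplication
   by Q ^ m, where Q = (x^3 - y^3)(y^3 - z^3)(z^3 - x^3). With A = y^3 - z^3,
   B = z^3 - x^3, S = x^2 y + y^2 z + z^2 x and T = x^2 z + y^2 x + z^2 y one has
     Q = - A B (A + B) = T^3 - S^3,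
     F4 a = (a - 1)/3 (A dB - B dA) - (T dS - S dT),
   and U^i V^j (U dV - V dU) = d (U^(i+1) V^(j+1) / (j+1)) as soon as
   i + j + 2 = l. (On the cubics U V (U + V) = c and U^3 - V^3 = c this says that
   the invariant differential is exact, i.e. that they are supersingular.)
   A primitive of Q ^ m F4 is killed by every rational vector field v tangent to
   the foliation, hence also by the derivation v^l; as P^2 has dimension two,
   v and v^l are then proportional.

   For the density, a nonzero f in Z[alpha] divides a nonzero integer N. If c is
   a nonzero integer with c alpha integral, a prime l = 2 mod 3 larger than |c|
   and |N| is not invertible in Z[alpha], so some maximal ideal contains l, and
   it does not contain f. *)
From HB Require Import structures.
Require Import Defs.
From mathcomp Require Import all_boot all_order all_algebra all_field.
From mathcomp Require classical_sets.
From mathcomp Require Import boolp mpoly.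
From mathcomp Require Import ring zify.

Set Implicit Arguments.
Unset Strict Implicit.
Unset Printing Implicit Defensive.

(** * Exactness of Q^m F4 in characteristic l = 3m + 2 *)

Section Exactness.
Import GRing.Theory.
Local Open Scope ring_scope.

Variables (L : fieldType) (l : nat).
Hypothesis charL : l \in [pchar L].

Definition exact_form (w : form1 L) : Prop :=
  exists F : {mpoly L[3]}, forall i, F^`M(i) = w i.

Lemma mderiv_exp n (R : comNzRingType) (i : 'I_n) (P : {mpoly R[n]}) k :
  (P ^+ k.+1)^`M(i) = k.+1%:R *: (P ^+ k * P^`M(i)).
Proof.
elim: k => [|k IHk]; first by rewrite expr1 expr0 mul1r scale1r.
rewrite exprS mderivM IHk -scalerAr mulrA -exprS mulrC -[X in X + _]scale1r.
by rewrite -scalerDl nat1r.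
Qed.

Lemma exact_formD w w' :
  exact_form w -> exact_form w' -> exact_form (fun i => w i + w' i).
Proof.
by move=> [F hF] [G hG]; exists (F + G) => i; rewrite mderivD hF hG.
Qed.

Lemma exact_formZ c w : exact_form w -> exact_form (fun i => c *: w i).
Proof. by move=> [F hF]; exists (c *: F) => i; rewrite mderivZ hF. Qed.

Lemma exact_form_sum n (w : 'I_n -> form1 L) :
  (forall k, exact_form (w k)) -> exact_form (fun i => \sum_k w k i).
Proof.
move=> /boolp.choice[F hF]; exists (\sum_k F k) => i.
by rewrite raddf_sum; apply: eq_bigr => k _; apply: hF.
Qed.

Lemma eq_exact_form w w' : w =1 w' -> exact_form w -> exact_form w'.
Proof. by move=> ww' [F hF]; exists F => i; rewrite hF. Qed.

Definition wronskian (U V : {mpoly L[3]}) : form1 L :=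
  fun i => U * V^`M(i) - V * U^`M(i).

(** As (i+1) + (j+1) = l vanishes in [L], the differential of U^(i+1) V^(j+1) is (j+1) U^i V^j (U dV
    - V dU), and j+1 is invertible because 0 < j+1 < l. *)
Lemma exact_monomial (U V : {mpoly L[3]}) i j : (i + j).+2 = l ->
  exact_form (fun k => U ^+ i * V ^+ j * wronskian U V k).
Proof.
move=> hl; have l0 : (i.+1 + j.+1)%:R = 0 :> L.
  by rewrite addSn addnS hl; apply: pcharf0.
have j0 : j.+1%:R != 0 :> L.
  by rewrite -(dvdn_pcharf charL) gtnNdvd// -hl ltnS ltnS leq_addl.
exists (j.+1%:R^-1 *: (U ^+ i.+1 * V ^+ j.+1)) => k.
rewrite mderivZ mderivM !mderiv_exp /wronskian -scalerAl -scalerAr scalerDr.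
rewrite !scalerA mulVf// scale1r.
have -> : j.+1%:R^-1 * i.+1%:R = -1 :> L.
  move/eqP: l0; rewrite natrD addr_eq0 => /eqP->.
  by rewrite mulrN mulVf.
rewrite scaleN1r !exprS; ring.
Qed.

Lemma exact_expD (w : form1 L) (W A B : {mpoly L[3]}) m :
    (forall k, (k <= m)%N ->
       exact_form (fun t => W * (A ^+ (m - k) * B ^+ k) * w t)) ->
  exact_form (fun t => W * (A + B) ^+ m * w t).
Proof.
move=> h; apply: (@eq_exact_form (fun t => \sum_(k < m.+1)
   'C(m, k)%:R *: (W * (A ^+ (m - k) * B ^+ k) * w t))).
  move=> t; rewrite exprDn mulr_sumr mulr_suml; apply: eq_bigr => k _.
  by rewrite scaler_nat mulrnAr mulrnAl.
by apply: exact_form_sum => k; apply/exact_formZ/h; rewrite -ltnS.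
Qed.

(** The cubic is homogeneous in [U] and [V], so each monomial of its m-th power has total degree 3m
    = l - 2, as [exact_monomial] requires. The Fermat cubic below is treated in the same way. *)
Lemma exact_additive_cubic (U V : {mpoly L[3]}) m : (3 * m).+2 = l ->
  exact_form (fun t => (U * V * (U + V)) ^+ m * wronskian U V t).
Proof.
move=> hl; apply: (@eq_exact_form (fun t =>
  (U ^+ m * V ^+ m) * (U + V) ^+ m * wronskian U V t)).
  by move=> t; rewrite -!exprMn.
apply: exact_expD => k km.
apply: (@eq_exact_form (fun t => U ^+ (m + (m - k)) * V ^+ (m + k) * wronskian U V t)).
  by move=> t; rewrite !exprD; ring.
by apply: exact_monomial; lia.
Qed.

Lemma exact_fermat_cubic (U V : {mpoly L[3]}) m : (3 * m).+2 = l ->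
  exact_form (fun t => (U ^+ 3 - V ^+ 3) ^+ m * wronskian U V t).
Proof.
move=> hl; apply: (@eq_exact_form (fun t =>
  1 * (U ^+ 3 - V ^+ 3) ^+ m * wronskian U V t)).
  by move=> t; rewrite mul1r.
apply: exact_expD => k km.
apply: (@eq_exact_form (fun t =>
  (-1) ^+ k *: (U ^+ (3 * (m - k)) * V ^+ (3 * k) * wronskian U V t))).
  move=> t; rewrite [(- V ^+ 3) ^+ k]exprNn -!exprM mul1r -mul_mpolyC rmorphXn rmorphN1.
  ring.
by apply/exact_formZ/exact_monomial; lia.
Qed.

(** The Q of the overview. Once [L] contains a primitive cube root of unity it splits into the nine
    lines of the dual Hesse arrangement, all invariant under the foliation. *)
Definition nine_lines : {mpoly L[3]} :=
  ('X_(inord 0) ^+ 3 - 'X_(inord 1) ^+ 3) *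
  ('X_(inord 1) ^+ 3 - 'X_(inord 2) ^+ 3) *
  ('X_(inord 2) ^+ 3 - 'X_(inord 0) ^+ 3).

Lemma mderiv_var n (i j : 'I_n) : ('X_j : {mpoly L[n]})^`M(i) = (j == i)%:R.
Proof.
rewrite mderivX mnm1E; case: eqP => [->|_]; last by rewrite scale0r.
have -> : (U_(i) - U_(i) = 0)%MM by apply/mnmP => k; rewrite mnmBE subnn mnm0E.
by rewrite mpolyX0 scale1r.
Qed.

Lemma F4_exact (a : L) m : (3 * m).+2 = l -> 3%:R != 0 :> L ->
  exact_form (fun t => nine_lines ^+ m * F4 a t).
Proof.
move=> hl L3.
pose x : {mpoly L[3]} := 'X_(inord 0).
pose y : {mpoly L[3]} := 'X_(inord 1).
pose z : {mpoly L[3]} := 'X_(inord 2).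
pose S1 := x ^+ 2 * y + y ^+ 2 * z + z ^+ 2 * x.
pose S2 := x ^+ 2 * z + y ^+ 2 * x + z ^+ 2 * y.
have hA := exact_additive_cubic (y ^+ 3 - z ^+ 3) (z ^+ 3 - x ^+ 3) hl.
have hS := exact_fermat_cubic S2 S1 hl.
(* The factor (-1)^m compensates the sign in A B (A + B) = - Q; the Fermat cubic T^3 - S^3 is Q
   itself. *)
have := exact_formD (exact_formZ ((a - 1) / 3%:R * (-1) ^+ m) hA)
          (exact_formZ (- 1) hS).
have QS : S2 ^+ 3 - S1 ^+ 3 = nine_lines.
  rewrite /S2 /S1 /nine_lines -/x -/y -/z; ring.
have QA : (y ^+ 3 - z ^+ 3) * (z ^+ 3 - x ^+ 3) *
    (y ^+ 3 - z ^+ 3 + (z ^+ 3 - x ^+ 3)) = - nine_lines.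
  rewrite /nine_lines -/x -/y -/z; ring.
apply: eq_exact_form => t.
rewrite QA QS [(- nine_lines) ^+ m]exprNn -!mul_mpolyC.
rewrite (rmorphM (@mpolyC 3 L)) rmorphXn !rmorphN1.
set c : L := (a - 1) / 3%:R.
(* Writing a = 1 + 3c removes the division by 3, so that what remains is a polynomial identity with
   integer coefficients. *)
have hc : a%:MP = 1 + 3%:R * c%:MP :> {mpoly L[3]}.
  by rewrite -(rmorph_nat (@mpolyC 3 L)) -rmorphM -(rmorph1 (@mpolyC 3 L)) -rmorphD
    /c mulrC divfK// addrC subrK.
have s2 : (-1) ^+ m * (-1) ^+ m = 1 :> {mpoly L[3]}.
  by rewrite -exprMn mulrN1 opprK expr1n.
transitivity (nine_lines ^+ m * (c%:MP * wronskian (y ^+ 3 - z ^+ 3) (z ^+ 3 - x ^+ 3) t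
   * ((-1) ^+ m * (-1) ^+ m) - wronskian S2 S1 t)); first by ring.
rewrite s2 mulr1; congr (_ * _).
rewrite /wronskian /S1 /S2 !(mderivD, mderivN, mderivM).
rewrite /x /y /z !mderiv_var -/x -/y -/z.
rewrite /F4 -/x -/y -/z hc.
move: (c%:MP) => {hc s2 hA hS QA QS} e; rewrite -/x -/y -/z; clearbody x y z.
case: t => [[|[|[|//]]] ?] /=; rewrite -!val_eqE /= !inordK//=; ring.
Qed.
End Exactness.

(** * Iterates of a derivation in characteristic l *)

Section IteratedDerivation.
Import GRing.Theory.
Local Open Scope ring_scope.

Variables (R : comNzRingType) (v : R -> R).
Hypothesis vD : {morph v : f g / f + g}.
Hypothesis vM : forall f g, v (f * g) = v f * g + f * v g.

Lemma iter_additive n : {morph iter n v : f g / f + g}.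
Proof. by elim: n => [|n IHn] f g //=; rewrite IHn vD. Qed.

Lemma leibniz_iter n f g :
  iter n v (f * g) =
  \sum_(i < n.+1) (iter (n - i) v f * iter i v g) *+ 'C(n, i).
Proof.
have v0 : v 0 = 0 by apply: (addrI (v 0)); rewrite -vD !addr0.
have vMn x k : v (x *+ k) = v x *+ k.
  by elim: k => [|k IHk]; rewrite ?mulr0n// !mulrS vD IHk.
elim: n => [|n IHn]; first by rewrite big_ord_recl big_ord0 /= bin0 addr0 mulr1n.
rewrite [LHS]/= IHn (big_morph v vD v0).
rewrite (eq_bigr (fun i : 'I_n.+1 =>
  (iter (n.+1 - i) v f * iter i v g) *+ 'C(n, i) +
  (iter (n - i) v f * iter i.+1 v g) *+ 'C(n, i))); last first.
  by move=> i _; rewrite vMn vM mulrnDl subSn// -ltnS.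
(* The two sums are shifted by one against each other; once the extreme terms are split off,
   Pascal's rule matches the rest. *)
rewrite big_split /= big_ord_recl [in RHS]big_ord_recl /= !bin0 -addrA.
congr (_ + _).
rewrite [X in _ + X]big_ord_recr /= addrA.
rewrite [in RHS]big_ord_recr /= !subnn !binn; congr (_ + _).
rewrite -big_split /=; apply: eq_bigr => i _.
by rewrite /bump /= !add1n subSS binS mulrnDr.
Qed.

(** In Leibniz' formula the binomial coefficients C(l, i) with 0 < i < l are divisible by l, so only
    the two extreme terms survive. *)
Lemma iter_prime_derivation l : l \in [pchar R] ->
  forall f g, iter l v (f * g) = iter l v f * g + f * iter l v g.
Proof.
move=> charR f g; have pl := pcharf_prime charR.
case: l charR pl => // l charR pl.
rewrite leibniz_iter big_ord_recl big_ord_recr bin0 mulr1n.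
rewrite big1 /= => [|i _].
  by rewrite add0r /bump /= add1n binn subnn mulr1n.
rewrite -mulr_natr; have /eqP -> : 'C(l.+1, bump 0 i)%:R == 0 :> R.
  by rewrite -(dvdn_pcharf charR) prime_dvd_bin// /bump /= add1n ltnS ltn_ord.
by rewrite mulr0.
Qed.

End IteratedDerivation.

(** * Derivations of a field of transcendence degree two, in coordinates *)

Section Derivation.
Import GRing.Theory.
Local Open Scope ring_scope.

Variables (L K : fieldType) (phi : {rmorphism {mpoly L[3]} -> K}).

Definition derivation (v : K -> K) : Prop :=
  [/\ forall c, v (phi c%:MP) = 0,
      {morph v : f g / f + g} &
      forall f g, v (f * g) = v f * g + f * v g].

Lemma derivation0 v : derivation v -> v 0 = 0.
Proof. by move=> [_ vD _]; apply: (addrI (v 0)); rewrite -vD !addr0. Qed.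

Lemma derivation1 v : derivation v -> v 1 = 0.
Proof. by move=> [vC _ _]; rewrite -(vC 1) !rmorph1. Qed.

Lemma derivation_iter l v :
  l \in [pchar K] -> derivation v -> derivation (iter l v).
Proof.
move=> charK hv; have [vC vD vM] := hv.
split; [move=> c | exact: iter_additive | exact: iter_prime_derivation].
have := prime_gt0 (pcharf_prime charK); case: (l) => // k _.
by rewrite iterSr vC; elim: k => //= k ->; apply: derivation0.
Qed.

(** The chain rule holds for constants and variables and is stable under sums and products. *)
Lemma derivation_chain v P : derivation v ->
  v (phi P) = \sum_i phi P^`M(i) * v (phi 'X_i).
Proof.
move=> hv; have [vC vD vM] := hv.
pose chain P := v (phi P) = \sum_i phi P^`M(i) * v (phi 'X_i).
have chainC c : chain c%:MP.
  rewrite /chain vC; apply/esym/big1 => i _.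
  by rewrite mderivC rmorph0 mul0r.
have chainD p q : chain p -> chain q -> chain (p + q).
  rewrite /chain rmorphD vD => -> ->; rewrite -big_split; apply: eq_bigr => i _.
  by rewrite mderivD rmorphD mulrDl.
have chainM p q : chain p -> chain q -> chain (p * q).
  rewrite /chain rmorphM vM => -> ->; rewrite mulr_suml mulr_sumr -big_split.
  apply: eq_bigr => i _ /=.
  by rewrite mderivM rmorphD !rmorphM mulrDl mulrAC mulrA.
have chainX i : chain 'X_i.
  rewrite /chain (bigD1 i)//= big1 => [|j ji].
    by rewrite mderiv_var eqxx rmorph1 mul1r addr0.
  by rewrite mderiv_var eq_sym (negPf ji) rmorph0 mul0r.
have chain1 : chain 1 by rewrite -mpolyC1; apply: chainC.
rewrite -/(chain P) (mpolyE P); apply: (big_ind chain) => //.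
  by rewrite -(mpolyC0 3); apply: chainC.
move=> m _; rewrite -mul_mpolyC; apply: (chainM _ _ (chainC _)).
rewrite mpolyXE_id; apply: (big_ind chain chain1 chainM) => i _.
by elim: (m i) => [|k IHk]; rewrite ?expr0// exprS; apply: chainM.
Qed.

Lemma sum_I3 (V : nmodType) (F : 'I_3 -> V) :
  \sum_i F i = F (inord 0) + F (inord 1) + F (inord 2).
Proof.
rewrite !big_ord_recl big_ord0 addr0 addrA.
by congr (F _ + F _ + F _); apply: val_inj; rewrite /= !inordK.
Qed.

(** Two properties of the dehomogenization X_0 = 1: the coordinate of index 0 becomes constant, and
    [K] is the fraction field of the image of [phi]. *)
Hypothesis phi0 : phi 'X_(inord 0) = 1.
Hypothesis phi_quotient :
  forall u, exists P Q, phi Q != 0 /\ u * phi Q = phi P.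

Lemma derivation_chain2 v P : derivation v ->
  v (phi P) = phi P^`M(inord 1) * v (phi 'X_(inord 1)) +
              phi P^`M(inord 2) * v (phi 'X_(inord 2)).
Proof.
move=> hv; rewrite derivation_chain// sum_I3 phi0.
by rewrite derivation1// mulr0 add0r.
Qed.

(** This is the quotient rule. The coefficients do not depend on the derivation, so the same ones
    serve for [v] and for its iterate. *)
Lemma derivation_coordinates u : exists p q, forall v, derivation v ->
  v u = p * v (phi 'X_(inord 1)) + q * v (phi 'X_(inord 2)).
Proof.
have [P [Q [Q0 uQ]]] := phi_quotient u.
exists ((phi P^`M(inord 1) - u * phi Q^`M(inord 1)) / phi Q).
exists ((phi P^`M(inord 2) - u * phi Q^`M(inord 2)) / phi Q).
move=> v hv; have [_ _ vM] := hv.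
have := derivation_chain2 P hv; rewrite -uQ vM (derivation_chain2 Q hv) => vP.
apply: (mulIf Q0); rewrite -[LHS](addrK (u *
  (phi Q^`M(inord 1) * v (phi 'X_(inord 1)) +
   phi Q^`M(inord 2) * v (phi 'X_(inord 2))))) vP.
by field.
Qed.

(* An exact multiple of [w] provides a function killed by both [v] and its
   [l]-fold iterate, and in dimension two this makes them proportional. *)
Lemma wedge_iter_eq0 l v (w : form1 L) Q :
    l \in [pchar K] -> derivation v ->
    \sum_i phi (w i) * v (phi 'X_i) = 0 ->
    phi (w (inord 1)) != 0 -> phi Q != 0 -> exact_form (fun i => Q * w i) ->
  forall f g, v f * iter l v g - v g * iter l v f = 0.
Proof.
move=> charK hv wv w1 Q0 [F hF] f g.
set s := phi 'X_(inord 1); set t := phi 'X_(inord 2).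
set a := phi (w (inord 1)) in w1; set b := phi (w (inord 2)).
have dF u : derivation u -> u (phi F) = phi Q * (a * u s + b * u t).
  by move=> hu; rewrite derivation_chain2// !hF !rmorphM mulrDr !mulrA.
have hvl := derivation_iter charK hv.
have vst : a * v s + b * v t = 0.
  by move: wv; rewrite sum_I3 phi0 derivation1// mulr0 add0r.
(* A derivation u sends F to Q w(u). Hence v(F) = 0, so v^l(F) = 0, and dividing by Q gives w(v^l) =
   0. *)
have vlst : a * iter l v s + b * iter l v t = 0.
  apply: (mulfI Q0); rewrite mulr0 -dF//.
  have := prime_gt0 (pcharf_prime charK); case: (l) => // k _.
  rewrite iterSr dF// vst mulr0.
  by elim: k => //= k ->; apply: derivation0.
(* The vectors (v s, v t) and (v^l s, v^l t) both solve a X + b Y = 0 with a nonzero, so their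
   determinant vanishes. *)
have D0 : v s * iter l v t - v t * iter l v s = 0.
  apply: (mulfI w1); rewrite mulr0.
  transitivity ((a * v s + b * v t) * iter l v t -
    (a * iter l v s + b * iter l v t) * v t); first by ring.
  by rewrite vst vlst !mul0r subr0.
have [p1 [q1 fE]] := derivation_coordinates f.
have [p2 [q2 gE]] := derivation_coordinates g.
rewrite !fE// !gE// -/s -/t.
transitivity ((p1 * q2 - q1 * p2) * (v s * iter l v t - v t * iter l v s)).
  by ring.
by rewrite D0 mulr0.
Qed.

End Derivation.

(** * The function field of the plane in the chart X_0 = 1 *)

Section FunctionField.
Import GRing.Theory.
Local Open Scope ring_scope.

Variable L : closedFieldType.
Local Notation K := (funfield L).
Local Notation "x %:F" := (@FracField.tofrac _ x).

Lemma fval_inj : injective (@fval L).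
Proof. exact: val_inj. Qed.

HB.instance Definition _ := GRing.RMorphism.copy (@fval L)
  (val : K -> {fraction {mpoly L[3]}}).

Lemma fconst_zmod_morphism : zmod_morphism (@fconst L).
Proof. by move=> c d; apply: fval_inj; rewrite /fval /= mpolyCB tofracB. Qed.

Lemma fconst_monoid_morphism : monoid_morphism (@fconst L).
Proof.
split; first by apply: fval_inj; rewrite /fval /= mpolyC1 tofrac1.
by move=> c d; apply: fval_inj; rewrite /fval /= mpolyCM tofracM.
Qed.

HB.instance Definition _ := GRing.isZmodMorphism.Build L K (@fconst L)
  fconst_zmod_morphism.
HB.instance Definition _ := GRing.isMonoidMorphism.Build L K (@fconst L)
  fconst_monoid_morphism.

Definition dehomog (P : {mpoly L[3]}) : K :=
  mmap (@fconst L) (fun i => fratio L i (inord 0)) P.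

HB.instance Definition _ := GRing.RMorphism.copy dehomog
  (mmap (@fconst L) (fun i => fratio L i (inord 0))).

Lemma dehomogC c : dehomog c%:MP = fconst c.
Proof. exact: mmapC. Qed.

Lemma dehomog_var i : dehomog 'X_i = fratio L i (inord 0).
Proof. by rewrite /dehomog mmapX mmap1U. Qed.

Lemma tofrac_var_neq0 i : ('X_i : {mpoly L[3]})%:F != 0.
Proof. by rewrite tofrac_eq0 -msupp_eq0 msuppX. Qed.

Lemma fratio_diag i : fratio L i i = 1.
Proof.
by apply: fval_inj; rewrite rmorph1 /fval /= divff// tofrac_var_neq0.
Qed.

Lemma fval_dehomog d (P : {mpoly L[3]}) : P \is d.-homog ->
  fval (dehomog P) = P%:F / ('X_(inord 0))%:F ^+ d.
Proof.
move=> hP; rewrite [in RHS](mpolyE P) {1}(mpolyE P).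
rewrite (rmorph_sum (@dehomog)) (rmorph_sum (@fval L)).
rewrite (rmorph_sum (@FracField.tofrac _)) mulr_suml.
rewrite !big_seq; apply: eq_bigr => m mP.
rewrite -mul_mpolyC !rmorphM/= dehomogC -mulrA; congr (_ * _).
rewrite mpolyXE_id !rmorph_prod/=.
have <- : mdeg m = d by move/dhomogP: hP => /(_ m mP).
rewrite mdegE -prodrXr -prodf_div.
apply: eq_bigr => i _; rewrite !rmorphXn /= dehomog_var -expr_div_n.
by [].
Qed.

(** Homogeneity matters here: [dehomog] kills X_0 - 1. *)
Lemma dehomog_neq0 d (P : {mpoly L[3]}) :
  P \is d.-homog -> P != 0 -> dehomog P != 0.
Proof.
move=> hP P0; apply/eqP => /(congr1 (@fval L)).
rewrite rmorph0 (fval_dehomog hP); apply/eqP.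
by rewrite mulf_neq0 ?invr_eq0 ?expf_neq0 ?tofrac_var_neq0// tofrac_eq0.
Qed.

Lemma funfield_quotient (u : K) :
  exists P Q, dehomog Q != 0 /\ u * dehomog Q = dehomog P.
Proof.
have [d [f [g [hf hg g0 uE]]]] := asboolW (valP u).
exists f, g; split; first exact: dehomog_neq0 hg g0.
apply: fval_inj; rewrite rmorphM /= (fval_dehomog hf) (fval_dehomog hg).
by rewrite /fval uE mulrA divfK// tofrac_eq0.
Qed.


(** A local generator is in particular a rational vector field annihilated by [w], and the vanishing
    of the bivector is an identity in the function field; so [wedge_iter_eq0] applies in the chart
    X_0 = 1. *)
Lemma p_closed_of_exact l d (w : form1 L) (Q : {mpoly L[3]}) e :
    l \in [pchar L] -> (forall i, w i \is d.-homog) -> w (inord 1) != 0 ->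
    Q != 0 -> Q \is e.-homog -> exact_form (fun i => Q * w i) ->
  p_closed l w.
Proof.
move=> charL hw w1 Q0 hQ exQ v [E [_ [q Eq] /(_ q Eq)[[hv wv _] _]]].
have charK : l \in [pchar K] by apply: (rmorph_pchar (@fconst L)).
have phi0 : dehomog 'X_(inord 0) = 1 by rewrite dehomog_var fratio_diag.
have vw : \sum_i dehomog (w i) * v (dehomog 'X_i) = 0.
  apply: fval_inj; rewrite rmorph0 (rmorph_sum (@fval L)).
  (* Dividing the homogeneous kernel equation for the chart of index 0 by X_0^d dehomogenizes it. *)
  transitivity ((\sum_(i < 3) (w i)%:F * fval (v (fratio L i (inord 0)))) /
   ('X_(inord 0))%:F ^+ d); last by rewrite wv mul0r.
  rewrite mulr_suml; apply: eq_bigr => i _.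
  by rewrite dehomog_var (rmorphM (@fval L)) /= (fval_dehomog (hw i)) mulrAC.
have dv : derivation dehomog v.
  have [vC vD vM] := hv; split=> // c.
  by rewrite -[X in v X]/(dehomog _) dehomogC.
apply: (wedge_iter_eq0 phi0 funfield_quotient charK dv vw _ _ exQ).
- exact: dehomog_neq0 (hw _) w1.
- exact: dehomog_neq0 hQ Q0.
Qed.

End FunctionField.

(** * The forms F4 over algebraically closed fields of characteristic l *)

Section Reduction.
Import GRing.Theory.
Local Open Scope ring_scope.

Lemma map_form_F4 (A B : comNzRingType) (h : {rmorphism A -> B}) a :
  map_form h (F4 a) = F4 (h a).
Proof.
apply/funext; case=> [[|[|[|//]]] ?]; rewrite /map_form /F4 /=;
by rewrite !(rmorphM, rmorphB, rmorphXn) /= map_mpolyC ?rmorph0// !map_mpolyX.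
Qed.

Lemma mevalXn (L : fieldType) (q : 'I_3 -> L) i k :
  ('X_i ^+ k).@[q] = q i ^+ k.
Proof. by rewrite rmorphXn /= mevalXU. Qed.

Lemma nine_lines_neq0 (L : fieldType) : nine_lines L != 0.
Proof.
have sub_neq0 (i j : 'I_3) : i != j -> 'X_i ^+ 3 - 'X_j ^+ 3 != 0 :> {mpoly L[3]}.
  (* At the i-th coordinate point the difference of cubes takes the value 1. *)
  move=> ij; apply/eqP => /(congr1 (meval (fun k => (k == i)%:R))).
  rewrite mevalB !mevalXn meval0 eqxx eq_sym (negPf ij) expr1n expr0n subr0.
  exact/eqP/oner_neq0.
by rewrite /nine_lines !mulf_neq0 ?sub_neq0// -val_eqE /= !inordK.
Qed.

Lemma nine_lines_homog (L : fieldType) : nine_lines L \is 9.-homog.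
Proof.
have hX (i : 'I_3) : ('X_i ^+ 3 : {mpoly L[3]}) \is 3.-homog.
  by rewrite -[X in X.-homog]mul1n dhomogMn// dhomogX /= mdeg1.
by apply: (@dhomogM _ _ _ 6 _ 3); [apply: (@dhomogM _ _ _ 3 _ 3)|];
  rewrite rpredB.
Qed.

Lemma F4_neq0 (L : fieldType) (a : L) : F4 a (inord 1) != 0.
Proof.
rewrite /F4 inordK//= mulf_neq0//.
  (* The factor z^3 - x^3 equals 1 at (0, 0, 1), and x z - a y^2 equals 1 at (1, 0, 1) for every
     a. *)
  apply/eqP => /(congr1 (meval (fun k => (k == inord 2)%:R))).
  rewrite mevalB !mevalXn meval0 eqxx -val_eqE /= !inordK//=.
  by rewrite expr1n expr0n subr0; apply/eqP/oner_neq0.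
apply/eqP => /(congr1 (meval (fun k => (k != inord 1)%:R))).
rewrite mevalB mevalM [(a%:MP * _).@[_]]mevalM mevalC mevalXn !mevalXU meval0 -!val_eqE /= !inordK//=.
by rewrite expr0n mulr0 mulr1 subr0; apply/eqP/oner_neq0.
Qed.

Lemma F4_p_closed (L : closedFieldType) (a : L) l :
  l \in [pchar L] -> (3 < l)%N -> (l = 2 %[mod 3])%N -> p_closed l (F4 a).
Proof.
move=> charL l3 l2.
have hl : (3 * (l %/ 3)).+2 = l by rewrite [RHS](divn_eq l 3) l2; lia.
have L3 : 3%:R != 0 :> L by rewrite -(dvdn_pcharf charL) gtnNdvd.
apply: (p_closed_of_exact charL (@F4_homog _ a) (F4_neq0 a) _ _
  (F4_exact charL a hl L3)).
  exact/expf_neq0/nine_lines_neq0.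
by apply: dhomogMn; apply: nine_lines_homog.
Qed.

End Reduction.

(** * Primes congruent to 2 modulo 3 *)

Lemma prime_divisor_2mod3 n :
  n = 2 %[mod 3] -> exists p, [/\ prime p, p %| n & p = 2 %[mod 3]].
Proof.
elim/ltn_ind: n => n IHn n2.
have n1 : 1 < n by move: n2; case: n {IHn} => [|[|]].
have [p2|p2] := eqVneq (pdiv n %% 3) 2.
  by exists (pdiv n); rewrite pdiv_prime// pdiv_dvd p2.
have nE := divnK (pdiv_dvd n).
(* If the smallest prime factor is not 2 modulo 3, the cofactor must be, because the product is; the
   induction continues there. *)
have [||q [pq qn q2]] := IHn (n %/ pdiv n).
- by rewrite ltn_Pdiv ?prime_gt1 ?pdiv_prime// ltnW.
- move: n2; rewrite -{1}nE -modnMm.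
  move: (ltn_pmod (pdiv n) (isT : 0 < 3)) (ltn_pmod (n %/ pdiv n) (isT : 0 < 3)) p2.
  by case: (pdiv n %% 3) => [|[|[|]]]//; case: (n %/ pdiv n %% 3) => [|[|[|]]].
by exists q; split=> //; rewrite -nE dvdn_mulr.
Qed.

Lemma infinitely_many_primes_2mod3 n :
  exists p, [/\ prime p, n < p & p = 2 %[mod 3]].
Proof.
have fn := fact_gt0 n.
(* Euclid's argument: 3 n! - 1 is 2 modulo 3 and has no prime factor up to n. *)
have [|p [pp pn p2]] := @prime_divisor_2mod3 (3 * n`!).-1.
  by move: fn; lia.
exists p; split=> //; rewrite ltnNge; apply/negP => pn'.
have pf : p %| 3 * n`! by rewrite dvdn_mull// dvdn_fact// prime_gt0.
have : p %| 1.
  have -> : 1 = 3 * n`! - (3 * n`!).-1 by lia.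
  by rewrite dvdn_sub.
by rewrite dvdn1 => /eqP p1; move: pp; rewrite p1.
Qed.

(** * Existence of closed points containing a given non-unit *)

Section MaximalIdeal.
Import GRing.Theory.
Local Open Scope ring_scope.
Variable R : comNzRingType.

Definition is_ideal (A : R -> Prop) : Prop :=
  [/\ A 0, ~ A 1 & forall r x y, A x -> A y -> A (r * x + y)].

Definition is_maximal (A : R -> Prop) : Prop := is_ideal A /\
  forall B : R -> Prop, is_ideal B -> (forall x, A x -> B x) ->
  forall x, B x -> A x.

(* The proof is an argument so that the ideal structures below can be inferred. *)
Definition pred_of_maximal (A : R -> Prop) (hA : is_maximal A) : {pred R} :=
  fun x => `[< A x >].

Section OfMaximal.
Variables (A : R -> Prop) (hA : is_maximal A).

Lemma pred_of_maximalP x : reflect (A x) (x \in pred_of_maximal hA).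
Proof. exact: asboolP. Qed.

Lemma pred_of_maximal_ideal : idealr_closed (pred_of_maximal hA).
Proof.
have [[A0 A1 AD] _] := hA; split.
- exact/pred_of_maximalP.
- exact/pred_of_maximalP.
- move=> r x y /pred_of_maximalP Ax /pred_of_maximalP Ay.
  by apply/pred_of_maximalP/AD.
Qed.

Lemma pred_of_maximal_prime : prime_idealr_closed (pred_of_maximal hA).
Proof.
have [[A0 A1 AD] maxA] := hA => u v /pred_of_maximalP Auv.
have [Au|Au] := asboolP (A u); first by apply/orP; left; apply/pred_of_maximalP.
apply/orP; right; apply/pred_of_maximalP; apply: contrapT => Av.
(* The ideal A + (u) is proper, since 1 = r u + b would give v = v b + r (u v) in A. Maximality then
   puts u in A. *)
apply: Au; apply: (maxA (fun x => exists b r, A b /\ x = r * u + b)).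
- split.
  + by exists 0, 0; rewrite mul0r addr0.
  + move=> [b [r [Ab r1]]]; apply: Av.
    suff -> : v = v * b + (r * (u * v) + 0) by apply/AD/AD.
    by rewrite -[LHS]mul1r r1; ring.
  + move=> r _ _ [b [s [Ab ->]]] [c [t [Ac ->]]].
    by exists (r * b + c), (r * s + t); split; [exact: AD|ring].
- by move=> x Ax; exists x, 0; rewrite mul0r add0r.
- by exists 0, 1; rewrite mul1r addr0.
Qed.

HB.instance Definition _ :=
  isIdealr.Build R (pred_of_maximal hA) pred_of_maximal_ideal.
HB.instance Definition _ :=
  isPrimeIdealrClosed.Build R (pred_of_maximal hA) pred_of_maximal_prime.

End OfMaximal.

Lemma exists_maximal_ideal (a : R) : (forall u, a * u <> 1) ->
  exists A, is_maximal A /\ A a.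
Proof.
move=> na; pose P (A : R -> Prop) := (forall x, ~ A x) \/ (is_ideal A /\ A a).
have [F FP totF|A [PA maxA]] := @classical_sets.Zorn_bigcup R P.
  have [[B [FB [hB Ba]]]|noB] := pselect (exists B, F B /\ is_ideal B /\ B a).
    have hF C x : F C -> C x -> is_ideal C.
      by move=> /FP[nC /nC|[]].
    have [B0 B1 BD] := hB.
    right; split; last by exists B.
    split; first by exists B.
      by move=> [C FC C1]; have [_ + _] := hF _ _ FC C1; apply.
    move=> r x y [C FC Cx] [D FD Dy].
    have [_ _ CD] := hF _ _ FC Cx; have [_ _ DD] := hF _ _ FD Dy.
    have [sCD|sDC] := totF _ _ FC FD.
      by exists D => //; apply: DD => //; apply: sCD.
    by exists C => //; apply: CD => //; apply: sDC.
  left=> x [C FC Cx]; apply: noB; exists C; split=> //.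
  by have [/(_ _ Cx)|] := FP _ FC.
have maxA' B : P B -> (forall x, A x -> B x) -> forall x, B x -> A x.
  move=> PB AB; apply: contrapT => BA.
  exact: (maxA B (conj AB BA) PB).
have idealaR : is_ideal (fun x => exists u, x = u * a).
  split; first by exists 0; rewrite mul0r.
    by move=> [u u1]; apply: (na u); rewrite mulrC.
  by move=> r _ _ [u ->] [v ->]; exists (r * u + v); ring.
have Aa : is_ideal A /\ A a.
  case: PA => // A0; exfalso; apply: (A0 a).
  apply: (maxA' (fun x => exists u, x = u * a)).
  - by right; split=> //; exists 1; rewrite mul1r.
  - by move=> x /A0.
  - by exists 1; rewrite mul1r.
exists A; split; last by case: Aa.
split; first by case: Aa.
by move=> B hB AB; apply: maxA' => //; right; split=> //; apply: AB; case: Aa.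
Qed.

Lemma exists_closed_point (a : R) : (forall u, a * u <> 1) ->
  exists p : Spec R, closed_point p /\ a \in p.
Proof.
move=> /exists_maximal_ideal[A [hA Aa]].
exists (pred_of_maximal hA); split; last exact/pred_of_maximalP.
have [_ maxA] := hA.
move=> J AJ x xJ; apply/pred_of_maximalP; apply: (maxA (fun x => x \in J)) => //.
- split; [exact: rpred0| by rewrite idealr1|].
  by move=> r y z yJ zJ; rewrite rpredD// idealMr.
- by move=> y Ay; apply: AJ; apply/pred_of_maximalP.
Qed.

End MaximalIdeal.

(** * Arithmetic of Z[alpha] and density of the closed points *)

Section Residue.
Import GRing.Theory Num.Theory.
Local Open Scope ring_scope.

Lemma residue_char_in (R : comNzRingType) (p : Spec R) l :
  prime l -> l%:R \in p -> residue_char p l.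
Proof.
move=> pl lp; rewrite /residue_char inE pl /=.
rewrite -(rmorph_nat (\pi_(residue p)%qT : {rmorphism R -> residue p})).
rewrite -(rmorph0 (\pi_(residue p)%qT : {rmorphism R -> residue p})).
by rewrite -Quotient.idealrBE subr0.
Qed.

Lemma algC_int_root (x : algC) :
  exists2 r : {poly int}, r != 0 & root (map_poly intr r) x.
Proof.
have [q [qE q_monic _]] := minCpolyP x.
have [r [a a0 rE]] := rat_poly_scale q.
have rx : (map_poly intr r).[x] = 0.
  have := root_minCpoly x; rewrite /root qE rE map_polyZ hornerZ mulf_eq0.
  rewrite fmorph_eq0 invr_eq0 intr_eq0 (negPf a0) /= -map_poly_comp.
  rewrite (eq_map_poly (g := intr)) => [/eqP//|z /=].
  by rewrite ratr_int.
exists r; last exact/eqP.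
apply: contraTneq q_monic => r0.
by rewrite rE r0 rmorph0 scaler0 monicE lead_coef0 eq_sym oner_eq0.
Qed.

Lemma algC_int_multiple (x : algC) :
  exists2 c : int, c != 0 & c%:~R * x \in Aint.
Proof.
have [r r0 /rootP rx] := algC_int_root x.
set c := lead_coef r; have c0 : c != 0 by rewrite lead_coef_eq0.
have c0C : c%:~R != 0 :> algC by rewrite intr_eq0.
exists c => //; pose n := (size r).-1.
have sr : size r = n.+1 by rewrite prednK// lt0n size_poly_eq0.
(* [P] is the monic integer polynomial with P(c X) = c^(n-1) r(X), so that c x is a root of it. The
   exponent n - 1 makes sense because a nonzero constant has no root. *)
pose P : {poly algC} := \poly_(i < n.+1)
  (if i == n then 1 else (r`_i)%:~R * c%:~R ^+ (n - i.+1)).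
apply: (@root_monic_Aint P).
- apply/rootP; rewrite (@horner_coef_wide _ n.+1) ?size_poly//.
  have [m nE] : exists m, n = m.+1.
    case: n sr {P} => [|m] sr; last by exists m.
    move: rx; rewrite (@horner_coef_wide _ 1) ?size_poly ?(leq_trans (size_poly _ _)) ?sr//.
    rewrite big_ord1 expr0 mulr1 coef_map /= => /eqP.
    by rewrite intr_eq0; move: c0; rewrite /c lead_coefE sr /= => /negPf ->.
  transitivity (c%:~R ^+ m * (map_poly intr r).[x]); last by rewrite rx mulr0.
  rewrite (@horner_coef_wide _ n.+1) ?(leq_trans (size_poly _ _)) ?sr//.
  rewrite mulr_sumr; apply: eq_bigr => i _; rewrite coef_poly ltn_ord coef_map /=.
  rewrite exprMn; case: eqP => [->|/eqP ni].
    rewrite mul1r nE exprS mulrAC mulrC /c lead_coefE sr nE /=.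
    by rewrite mulrA.
  have -> : m = (n - i.+1 + i)%N.
    by move/eqP: ni => ni; have := ltn_ord i; lia.
  by rewrite exprD; ring.
- rewrite monicE lead_coefE [size P]size_poly_eq ?eqxx ?oner_eq0//.
  by rewrite /= coef_poly ltnSn eqxx.
- apply/polyOverP => i; rewrite coef_poly; case: ifP => _; last exact: rpred0.
  case: eqP => _; first exact: rpred1.
  by rewrite rpredM ?rpredX ?intr_int.
Qed.

Variable alpha : algC.
Local Notation R := (Zadjoin alpha).

(** If u = g(alpha) were an inverse of l, then c^n u with n = [size g] would be an algebraic integer
    equal to the rational number c^n / l, hence an integer, and l would divide c. *)
Lemma Zadjoin_nonunit (c : int) l : c%:~R * alpha \in Aint ->
  prime l -> ~~ (l %| `|c|)%N -> forall u : R, l%:R * u <> 1.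
Proof.
move=> cA pl lc u /(congr1 val); rewrite rmorphM rmorph_nat rmorph1 /= => lu.
have /asboolP[g gE] := valP u.
pose n := size g.
have cu : c%:~R ^+ n * val u \in Aint.
  rewrite gE (@horner_coef_wide _ n) ?size_poly// mulr_sumr rpred_sum// => i _.
  have -> : c%:~R ^+ n = c%:~R ^+ i * c%:~R ^+ (n - i) :> algC.
    by rewrite -exprD subnKC// ltnW.
  have -> (e : algC) : c%:~R ^+ i * e * ((map_poly intr g)`_i * alpha ^+ i) =
    (map_poly intr g)`_i * e * (c%:~R * alpha) ^+ i by rewrite exprMn; ring.
  by rewrite !rpredM ?rpredX// ?Aint_int// coef_map /= Aint_int.
have l0 : l%:R != 0 :> algC by rewrite pnatr_eq0 -lt0n prime_gt0.
have uE : val u = l%:R^-1 by apply: (mulfI l0); rewrite lu divff.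
have : c%:~R ^+ n * val u \in Num.int.
  by apply: Cint_rat_Aint => //; rewrite uE rpredM ?rpredX ?rpredV ?rpred_int ?rpred_nat.
move=> /intrP[z zE]; move/negP: lc; apply.
have : c ^+ n = z * l%:Z.
  apply: (@intr_inj algC); rewrite rmorphXn rmorphM /= -zE uE.
  by rewrite mulfVK.
move=> /(congr1 absz); rewrite abszX abszM absz_nat => cnE.
have : (l %| `|c| ^ n)%N by rewrite cnE dvdn_mull.
by rewrite Euclid_dvdX// => /andP[].
Qed.

(** Take an integer polynomial killing f and cancel factors X, which is possible as f is nonzero in
    a domain, until it is p X + c with c nonzero; then - p(f) f = c. *)
Lemma Zadjoin_dvd_int (f : R) : f != 0 ->
  exists (g : R) (N : int), N != 0 /\ g * f = N%:~R.
Proof.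
move=> f0; have [r r0 /rootP rx] := algC_int_root (val f).
have rf : (map_poly intr r).[f] = 0 :> R.
  apply: val_inj; rewrite rmorph0 -horner_map -map_poly_comp /=.
  rewrite (eq_map_poly (g := intr))// => z; exact: (rmorph_int (val : {rmorphism R -> algC})).
elim/poly_ind: r r0 rf {rx} => [|p c IHp]; first by rewrite eqxx.
rewrite rmorphD rmorphM /= map_polyX map_polyC hornerD hornerM hornerX hornerC.
move=> pc0 rf; have [c0|c0] := eqVneq c 0; last first.
  exists (- (map_poly intr p).[f]), c; split=> //.
  by apply/eqP; rewrite -subr_eq0 mulNr -opprD rf oppr0.
apply: IHp; first by apply: contraNneq pc0 => ->; rewrite c0 mul0r add0r.
move: rf; rewrite c0 /= addr0 => /(congr1 val)/eqP.
rewrite rmorphM rmorph0 mulf_eq0 => /orP[|/eqP vf]; last first.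
  by case/eqP: f0; apply: val_inj; rewrite vf.
by move=> /eqP h; apply: val_inj; rewrite h rmorph0.
Qed.

Lemma zariski_dense_primes_2mod3 :
  zariski_dense (fun p : Spec R => closed_point p /\
    exists l : nat, [/\ residue_char p l, (3 < l)%N & (l = 2 %[mod 3])%N]).
Proof.
have [c c0 cA] := algC_int_multiple alpha.
move=> E hE p f Ef; have [->|f0] := eqVneq f 0; first exact: rpred0.
have [g [N [N0 gfN]]] := Zadjoin_dvd_int f0.
(* The bound makes l exceed 3 and divide neither [c] nor [N]. *)
have [l [pl lM l2]] := infinitely_many_primes_2mod3 (`|c| + `|N| + 3).
have lc : ~~ (l %| `|c|)%N by apply/negP => /dvdn_leq; lia.
have lN : coprime l `|N|.
  by rewrite prime_coprime//; apply/negP => /dvdn_leq; lia.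
have [q [q_closed lq]] := exists_closed_point (Zadjoin_nonunit cA pl lc).
(* As q belongs to the set, it contains f, hence also N; together with l in q and the coprimality of
   l and N this forces 1 into q. *)
have fq : f \in q.
  apply: (hE q) => //; split=> //; exists l; split=> //; last by lia.
  exact: residue_char_in.
have Nq : N%:~R \in q by rewrite -gfN idealMr.
have [u [v uv]] : exists u v : int, u * l%:Z + v * N = 1.
  have [u [v uv]] := Bezoutz l N; exists u, v; rewrite uv.
  by move/eqP: lN; rewrite /gcdz absz_nat => ->.
suff : (1 : R) \in q by rewrite idealr1.
rewrite -(rmorph1 (intr : {rmorphism int -> R})) -uv rmorphD !rmorphM /=.
by rewrite rpredD// idealMr.
Qed.

End Residue.

Theorem theorem6p10 (alpha : algC) (halpha : ~ Qadjoin omega alpha) :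
  (forall (p : Spec (Zadjoin alpha)) (l : nat),
     closed_point p -> residue_char p l -> 3 < l -> l = 2 %[mod 3] ->
     p_closed_mod l (reduction p (F4 (Zgen alpha)))) /\
  zariski_dense (fun p : Spec (Zadjoin alpha) =>
     closed_point p /\
     exists l : nat, [/\ residue_char p l, 3 < l & l = 2 %[mod 3]]).
Proof.
split; last exact: zariski_dense_primes_2mod3.
move=> p l _ charp l3 l2 L iota _.
(* Reduction and base change both turn [F4] into [F4] of the image of alpha, so only a statement
   over [L], again of characteristic l, remains. *)
rewrite /reduction !map_form_F4; apply: F4_p_closed => //.
exact: (GRing.rmorph_pchar iota).
Qed.
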